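(* Let $\mathcal{C}=\bigcup_{n\ge 1}\mathcal{C}(\mathbb{T}^n)$ be a Boyd--Lawton collection of functions, let $n\ge1$, let $g\in\mathcal{C}(\mathbb{T}^n)$, and let $m$ be a positive integer. Then $$\int_{\mathbb{T}^n} g\,d\tau_n=\lim_{\mu(q_A)\to\infty}\int_{\mathbb{T}^m} g\circ q_A\,d\tau_m,$$ where $q_A$ varies among continuous homomorphisms $\mathbb{T}^m\to\mathbb{T}^n$ (with $m$ and $n$ fixed).
   Context: $\mathbb{T}$ is the unit circle in $\mathbb{C}$; $\mathbb{T}^n=\{(z_1,\dots,z_n)\in\mathbb{C}^n: |z_1|=\dots=|z_n|=1\}$ is a compact group under coordinatewise multiplication, with normalized Haar measure $\tau_n$ (total mass 1); $\tau=\tau_1$. For an $n\times m$ integer matrix $A=(a_{ij})$, $q_A\colon\mathbb{T}^m\to\mathbb{T}^n$ is the continuous homomorphism $q_A(z_1,\dots,z_m)=(z_1^{a_{11}}z_2^{a_{12}}\cdots z_m^{a_{1m}},\dots,z_1^{a_{n1}}z_2^{a_{n2}}\cdots z_m^{a_{nm}})$. Every continuous homomorphism $\mathbb{T}^m\to\mathbb{T}^n$ is $q_A$ for a unique such $A$. A vector $\mathbf{r}\in\mathbb{Z}^n$ is viewed as an $n\times1$ matrix, so $q_{\mathbf{r}}\colon\mathbb{T}\to\mathbb{T}^n$, $q_{\mathbf r}(z)=(z^{r_1},\dots,z^{r_n})$. The Boyd height is $\mu(q_A)=\mu(A)=\min\{\|\mathbf{v}\|_\infty:\mathbf{v}\in\mathbb{Z}^n,\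 \mathbf{v}\ne\mathbf{0},\ \mathbf{v}\cdot A=\mathbf{0}\}$ ($\mathbf v$ a row vector, $\|\mathbf v\|_\infty$ the largest absolute value of a coordinate), and $\mu(q_A)=\infty$ if no such $\mathbf{v}$ exists. A Boyd--Lawton collection $\mathcal{C}=\bigcup_{n\ge1}\mathcal{C}(\mathbb{T}^n)$ is a collection of functions such that: (1) If $g\in\mathcal{C}(\mathbb{T}^n)$ then $g$ is defined and complex-valued almost everywhere on $\mathbb{T}^n$ and is integrable (it gives an element of $L^1(\mathbb{T}^n)$). (2) For each $g\in\mathcal{C}(\mathbb{T}^n)$ with $n\ge2$, $\int_{\mathbb{T}^n}g\,d\tau_n=\lim_{\mu(q_{\mathbf r})\to\infty}\int_{\mathbb{T}}g\circ q_{\mathbf r}\,d\tau$, where $q_{\mathbf r}\colon\mathbb{T}\to\mathbb{T}^n$ varies over the homomorphisms given by $\mathbf r\in\mathbb{Z}^n$ (implicit: for all large enough $\mu(q_{\mathbf r})$ the function $g\circ q_{\mathbf r}$ is integrable). (3) If $g\in\mathcal{C}(\mathbb{T}^n)$, there is a bound $B$ such that for every $m\ge1$ and every $q_A\colon\mathbb{T}^m\to\mathbb{T}^n$ with $\mu(q_A)\ge B$, the composition $g\circ q_A$ is in $\mathcal{C}(\mathbb{T}^m)$. Functions are actual (partially defined) functions, not almost-everywhere classes; $g\circ q_A$ is defined at the points that $q_A$ maps into the domain of $g$. A limit $\lim_{\mu(q_A)\to\infty}F(A)=L$ means: for every $\varepsilon>0$ there is a real $M$ such that $|F(A)-L|<\varepsilon$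 for all $A$ in the given range with $\mu(q_A)\ge M$ (including $\mu(q_A)=\infty$). *)

(* Defs.v *)
From HB Require Import structures.
From mathcomp Require Import all_boot all_order all_algebra.
From mathcomp Require Import complex.
From mathcomp Require Import all_classical all_reals all_analysis.

Set Implicit Arguments.
Unset Strict Implicit.
Unset Printing Implicit Defensive.

Import Order.TTheory GRing.Theory Num.Theory.
Import numFieldNormedType.Exports.

Local Open Scope classical_set_scope.
Local Open Scope complex_scope.
Local Open Scope ring_scope.

Definition torus_pred (R : realType) (n : nat) : pred 'rV[R[i]]_n :=
  fun z => [forall j, `|z 0 j| == 1].

Definition torus (R : realType) (n : nat) : Type :=
  {z : 'rV[R[i]]_n | torus_pred z}.

HB.instance Definition _ (R : realType) (n : nat) :=
  SubChoice.copy (torus R n) {z : 'rV[R[i]]_n | torus_pred z}.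

Lemma torus_pred1 (R : realType) (n : nat) : torus_pred (const_mx 1 : 'rV[R[i]]_n).
Proof. by apply/forallP => j; rewrite mxE normr1. Qed.

HB.instance Definition _ (R : realType) (n : nat) :=
  isPointed.Build (torus R n) (Sub (const_mx 1) (@torus_pred1 R n)).

(* [R[i]^o] is [R[i]] seen with its norm topology; the open subsets of T^n are
   those induced by the topology of C^n. *)
Definition torus_open (R : realType) (n : nat) : set_system (torus R n) :=
  [set val @^-1` (V : set 'rV[R[i]]_n) | V in @open 'rV[R[i]^o]_n].

HB.instance Definition _ (R : realType) (n : nat) :=
  @isMeasurable.Build (sigma_display (@torus_open R n)) (torus R n)
    <<s @torus_open R n >> (@sigma_algebra0 _ setT (@torus_open R n))
    (@sigma_algebraC _ (@torus_open R n)) (@sigma_algebra_bigcup _ setT _).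

Lemma torus_mul_subproof (R : realType) (n : nat) (z w : torus R n) :
  torus_pred (\row_j (val z 0 j * val w 0 j)).
Proof.
apply/forallP => j; rewrite mxE normrM.
by rewrite (eqP (forallP (valP z) j)) (eqP (forallP (valP w) j)) mulr1.
Qed.

Definition torus_mul (R : realType) (n : nat) (z w : torus R n) : torus R n :=
  Sub (\row_j (val z 0 j * val w 0 j)) (torus_mul_subproof z w).

Lemma torus_hom_subproof (R : realType) (n m : nat) (A : 'M[int]_(n, m))
    (z : torus R m) :
  torus_pred (\row_(i < n) \prod_(j < m) (val z 0 j) ^ (A i j)).
Proof.
apply/forallP => i; rewrite mxE normr_prod big1 // => j _.
have zj := eqP (forallP (valP z) j).
by case: (A i j) => k; rewrite ?NegzE ?exprzN ?normfV normrX zj expr1n ?invr1.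
Qed.

Definition torus_hom (R : realType) (n m : nat) (A : 'M[int]_(n, m))
    (z : torus R m) : torus R n :=
  Sub (\row_(i < n) \prod_(j < m) (val z 0 j) ^ (A i j))
      (torus_hom_subproof A z).

(* The total mass is 1 because [tau] is a probability. *)
Definition normalized_haar (R : realType) (n : nat)
    (tau : probability (torus R n) R) : Prop :=
  forall (z : torus R n) (A : set (torus R n)),
    measurable A -> tau (torus_mul z @` A) = tau A.

Definition supnorm (n : nat) (v : 'rV[int]_n) : nat := \max_(j < n) `|v 0%R j|%N.

(* The Boyd height mu(A): an infimum of natural numbers, hence a minimum, and
   +oo when the set is empty. *)
Definition boyd_height (R : realType) (n m : nat) (A : 'M[int]_(n, m)) : \bar R :=
  ereal_inf [set ((supnorm v)%:R : R)%:E |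
             v in [set v : 'rV[int]_n | v != 0 /\ v *m A = 0]].

Definition height_lim (R : realType) (n m : nat)
    (F : 'M[int]_(n, m) -> R[i]) (L : R[i]) : Prop :=
  forall eps : R, 0 < eps ->
    exists M : R, forall A : 'M[int]_(n, m),
      (M%:E <= boyd_height R A)%E -> `|F A - L| < eps%:C.

(* Partially defined complex functions on T^n; [None] means "undefined". *)
Definition partial_fun (R : realType) (n : nat) : Type := torus R n -> option R[i].

(* [h] is a Borel integrable representative of the class of [g] in L^1; in
   particular [g] is defined almost everywhere, but [g] itself is only required
   to be measurable for the completion of [mu]. *)
Definition L1_rep (R : realType) (n : nat) (mu : probability (torus R n) R)
    (g : partial_fun R n) (h : torus R n -> R[i]) : Prop :=
  [/\ mu.-integrable setT (fun x => (complex.Re (h x))%:E),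
      mu.-integrable setT (fun x => (complex.Im (h x))%:E) &
      {ae mu, forall x, g x = Some (h x)}].

Definition inL1 (R : realType) (n : nat) (mu : probability (torus R n) R)
    (g : partial_fun R n) : Prop := exists h, L1_rep mu g h.

(* The integral of any representative (they all have the same integral). The
   value is 0 if [g] is not in L^1. *)
Definition pintegral (R : realType) (n : nat) (mu : probability (torus R n) R)
    (g : partial_fun R n) : R[i] :=
  let h := xget (fun=> 0) (L1_rep mu g) in
  (\int[mu]_x complex.Re (h x)) +i* (\int[mu]_x complex.Im (h x)).

(* The integral of [g] over T^n is the limit of the integrals of the [g o q_A]
   over T^m, which exist once the height of [A] is large enough. *)
Definition integral_is_limit (R : realType)
    (tau : forall n, probability (torus R n) R) (n m : nat) (g : partial_fun R n) : Prop :=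
  (exists M : R, forall A : 'M[int]_(n, m),
     (M%:E <= boyd_height R A)%E -> inL1 (tau m) (g \o torus_hom A)) /\
  height_lim (fun A : 'M[int]_(n, m) => pintegral (tau m) (g \o torus_hom A))
             (pintegral (tau n) g).

(* Only the [C n] with [0 < n] matter. In [bl_limit] the vectors r in Z^n are
   the n x 1 matrices. *)
Record boyd_lawton (R : realType) (tau : forall n, probability (torus R n) R)
    (C : forall n, set (partial_fun R n)) : Prop := BoydLawton {
  bl_integrable : forall n (g : partial_fun R n), (0 < n)%N -> C n g -> inL1 (tau n) g;
  bl_limit : forall n (g : partial_fun R n), (2 <= n)%N -> C n g ->
    integral_is_limit tau 1 g;
  bl_comp : forall n (g : partial_fun R n), (0 < n)%N -> C n g ->
    exists B : R, forall m (A : 'M[int]_(n, m)), (0 < m)%N ->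
      (B%:E <= boyd_height R A)%E -> C m (g \o torus_hom A)
}.

(* Main.v *)
Require Import Defs.
From HB Require Import structures.
From mathcomp Require Import all_boot all_order all_algebra.
From mathcomp Require Import complex.
From mathcomp Require Import all_classical all_reals all_analysis.
From mathcomp Require Import measurable_realfun lra zify.

Set Implicit Arguments.
Unset Strict Implicit.
Unset Printing Implicit Defensive.

Import Order.TTheory GRing.Theory Num.Theory.
Local Open Scope classical_set_scope.
Local Open Scope ring_scope.

(** For [n >= 2] the limit over all homomorphisms reduces to the limit over those
    from the circle, which the collection provides and which settles [m = 1].
    Fix [A] of large height. The function
    [g o q_A] is again in the collection, so for [m >= 2] its integral is
    approximated by that of [g o q_A o q_r = g o q_(A r)] as soon as the height
    of [r] is large ([torus_hom_comp]); vectors [r] of arbitrarily large height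
    exist: take the powers of a large integer ([exists_boyd_height_ge]). If a
    short [v != 0] kills [A r], then [v A] is not zero because [A] has large
    height, and it is a vector of controlled size that kills [r]; so [A r] has
    large height when [A] has and the height of [r] is large depending on [A]
    ([boyd_height_mulmx]). Hence the integral of [g o q_(A r)] is also close to
    that of [g], and the triangle inequality concludes
    ([integral_is_limit_dim_ge2]).

    For [n = 1] the limit property of the collection says nothing, but a height
    of at least 2 is equivalent to [A != 0]. Then [q_A] is a surjection onto the
    circle, so it carries Haar measure to an invariant probability, which must
    be Haar measure ([haar_torus_hom]): the integrals of [g o q_A] and [g] are
    equal ([integral_is_limit_dim1]). Uniqueness of Haar measure
    ([haar_unique]) is the usual Fubini argument, for which the multiplication
    of the torus has to be measurable for the product of the two Borel
    sigma-algebras; this rests on the second countability of the torus, used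
    through [measurable_fun_torus]. *)

(** * Composition of the homomorphisms of tori *)

Lemma torus_coord_neq0 (R : realType) n (z : torus R n) j : val z 0 j != 0.
Proof. by rewrite -normr_gt0 (eqP (forallP (valP z) j)). Qed.

Lemma prod_exprz_prod (F : fieldType) m p (x : 'I_p -> F) (a : 'I_m -> int)
    (b : 'I_m -> 'I_p -> int) : (forall k, x k != 0) ->
  \prod_j (\prod_k x k ^ b j k) ^ a j = \prod_k x k ^ (\sum_j a j * b j k).
Proof.
move=> x0; transitivity (\prod_j \prod_k x k ^ (a j * b j k)).
  apply: eq_bigr => j _.
  rewrite (big_morph (fun y => y ^ a j) (id1 := 1) (op1 := *%R)) ?exp1rz //.
    by apply: eq_bigr => k _; rewrite exprz_exp mulrC.
  by move=> y z; rewrite expfzMl.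
rewrite exchange_big; apply: eq_bigr => k _ /=.
rewrite (big_morph (fun e => x k ^ e) (id1 := 1) (op1 := *%R)) // => c d.
exact: expfzDr.
Qed.

Lemma torus_hom_comp (R : realType) n m p (A : 'M[int]_(n, m))
    (B : 'M[int]_(m, p)) :
  torus_hom A \o torus_hom B = torus_hom (A *m B) :> (torus R p -> torus R n).
Proof.
apply/funext => z; apply: val_inj; apply/rowP => i; rewrite /= !mxE.
under eq_bigr do rewrite mxE.
rewrite [LHS](prod_exprz_prod (A i) B (torus_coord_neq0 z)).
by apply: eq_bigr => k _; rewrite mxE.
Qed.

Lemma torus_hom_mul (R : realType) n m (A : 'M[int]_(n, m)) (z w : torus R m) :
  torus_hom A (torus_mul z w) = torus_mul (torus_hom A z) (torus_hom A w).
Proof.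
apply: val_inj; apply/rowP => i; rewrite /= !mxE -[RHS]big_split /=.
by apply: eq_bigr => j _; rewrite mxE expfzMl.
Qed.

(** * The Boyd height *)

Lemma le_boyd_heightP (R : realType) n m (A : 'M[int]_(n, m)) (M : R) :
  (M%:E <= boyd_height R A)%E <->
  forall v : 'rV[int]_n, v != 0 -> v *m A = 0 -> M <= (supnorm v)%:R.
Proof.
split=> [MA v v0 vA|MA]; last first.
  by apply: le_ereal_inf_tmp => _ [v [v0 vA] <-]; rewrite lee_fin MA.
rewrite -lee_fin; apply: (le_trans MA); apply: ereal_inf_lbound.
by exists v.
Qed.

Lemma leq_supnorm n (v : 'rV[int]_n) j : (`|v ord0 j|%N <= supnorm v)%N.
Proof. exact: (leq_bigmax (F := fun j => `|v ord0 j|%N)). Qed.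

(** A crude bound for the operator norm of [v |-> v *m A]. *)
Definition entry_sum n m (A : 'M[int]_(n, m)) : nat :=
  (\sum_i \sum_j `|A i j|)%N.

Lemma supnorm_mulmx n m (v : 'rV[int]_n) (A : 'M[int]_(n, m)) :
  (supnorm (v *m A) <= supnorm v * entry_sum A)%N.
Proof.
apply/bigmax_leqP => j _; rewrite mxE.
have /leq_trans-> // : (`|(\sum_k v ord0 k * A k j)%R| <=
    \sum_k `|(v ord0 k * A k j)%R|)%N.
  apply: (big_ind2 (fun (x : int) (y : nat) => `|x| <= y)%N) => // a b c d ab cd.
  lia.
rewrite /entry_sum big_distrr /=; apply: leq_sum => k _; rewrite abszM.
by rewrite leq_mul ?leq_supnorm // (bigD1 j) //= leq_addr.
Qed.

(** A nonzero [v] with [v A B = 0] either kills [A], so that it is long, or gives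
    a nonzero vector [v A] that kills [B]; then [v A] is long, and so is [v],
    because multiplication by [A] expands norms by a bounded factor. *)
Lemma boyd_height_mulmx (R : realType) n m (A : 'M[int]_(n, m)) (M : R) :
  (M%:E <= boyd_height R A)%E ->
  exists K : R, forall p (B : 'M[int]_(m, p)),
    (K%:E <= boyd_height R B)%E -> (M%:E <= boyd_height R (A *m B))%E.
Proof.
move=> /le_boyd_heightP MA; exists (M * (entry_sum A)%:R + 1) => p B.
move=> /le_boyd_heightP KB; apply/le_boyd_heightP => v v0 vAB.
have [vA|vA] := eqVneq (v *m A) 0; first exact: MA.
rewrite leNgt; apply/negP => vM.
have := KB _ vA; rewrite -mulmxA => /(_ vAB); apply/negP; rewrite -ltNge.
apply: (@le_lt_trans _ _ ((supnorm v)%:R * (entry_sum A)%:R)).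
  by rewrite -natrM ler_nat supnorm_mulmx.
by rewrite ltr_pwDr // ler_wpM2r // ltW.
Qed.

(** Powers of [N] are independent with respect to small coefficients: the
    lowest digit is a multiple of [N], hence zero, and one divides by [N]. *)
Lemma digits_eq0 (N m : nat) (f : 'I_m -> int) :
  (forall j, (`|f j| < N)%N) -> \sum_(j < m) f j * N%:Z ^+ j = 0 ->
  forall j, f j = 0.
Proof.
elim: m f => [f _ _ [] //|m IH f fN].
rewrite big_ord_recl expr0 mulr1.
under eq_bigr do rewrite /= exprS mulrCA.
rewrite -mulr_sumr => S0.
have f0 : f ord0 = 0.
  apply/eqP; rewrite -absz_eq0; move: (fN ord0).
  have : (N %| `|f ord0|)%N.
    have -> : f ord0 = - (N%:Z * \sum_(i < m) f (lift ord0 i) * N%:Z ^+ i).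
      by apply/eqP; rewrite -addr_eq0 S0.
    by rewrite abszN abszM dvdn_mulr.
  by case: (`|f ord0|)%N => // k /dvdn_leq -/(_ isT); rewrite leqNgt => /negbTE->.
have N0 : N%:Z != 0 by have := fN ord0; case: (N).
move: S0; rewrite f0 add0r => /eqP; rewrite mulf_eq0 (negbTE N0) /= => /eqP S0.
move=> j; have [->//|] := eqVneq j ord0.
rewrite eq_sym => /unlift_some[k -> _].
by apply: (IH (fun k => f (lift ord0 k))) => // i; exact: fN.
Qed.

(** A nonzero [v] shorter than [N] cannot kill the column of the powers of [N]. *)
Lemma exists_boyd_height_ge (R : realType) m (K : R) :
  exists r : 'M[int]_(m, 1), (K%:E <= boyd_height R r)%E.
Proof.
pose N := (Num.trunc K).+1.
exists (\col_j N%:Z ^+ j); apply/le_boyd_heightP => v v0 vr.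
rewrite leNgt; apply/negP => vK; move/eqP: v0; apply.
apply/rowP => j; rewrite mxE.
apply: (@digits_eq0 N m (fun j => v ord0 j)).
  move=> i; apply: leq_ltn_trans (leq_supnorm _ _) _.
  by rewrite -(ltr_nat R) (lt_trans vK) // truncnS_gt.
move/matrixP: vr => /(_ ord0 ord0); rewrite !mxE => vr0.
by rewrite -[RHS]vr0; apply: eq_bigr => i _; rewrite mxE.
Qed.

(** * The case of dimension at least two *)

Lemma integral_is_limit_dim_ge2 (R : realType)
  (tau : forall n : nat, probability (torus R n) R)
  (C : forall n : nat, set (partial_fun R n)) (hC : boyd_lawton tau C)
  (n : nat) (hn : (2 <= n)%N) (g : partial_fun R n) (hg : C n g)
  (m : nat) (hm : (0 < m)%N) :
  integral_is_limit tau m g.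
Proof.
have [B gB] := bl_comp hC (ltnW hn) hg.
split.
  by exists B => A BA; apply: (bl_integrable hC) => //; exact: gB.
have [_ glim] := bl_limit hC hn hg.
have [m1|m2] := leqP m 1.
  by have -> : m = 1%N by apply/eqP; rewrite eqn_leq m1.
move=> eps eps0; have eps2 : 0 < eps / 2 by rewrite divr_gt0.
have [M gM] := glim _ eps2.
exists (Num.max M B) => A.
rewrite EFin_max ge_max => /andP[MA BA].
have [_ /(_ _ eps2)[M' gAM']] := bl_limit hC m2 (gB _ _ hm BA).
have [K AK] := boyd_height_mulmx MA.
have [r] := exists_boyd_height_ge m (Num.max K M').
rewrite EFin_max ge_max => /andP[/AK/gM gr /gAM'].
rewrite -compA torus_hom_comp distrC => gAr.
have -> : (eps%:C = (eps / 2)%:C + (eps / 2)%:C)%C by rewrite -rmorphD -splitr.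
exact: le_lt_trans (ler_distD _ _ _) (ltrD gAr gr).
Qed.

(** * Measurable maps into a torus *)

Definition measurable_complex d (X : measurableType d) (R : realType)
    (f : X -> R[i]) : Prop :=
  measurable_fun setT (fun x => complex.Re (f x)) /\
  measurable_fun setT (fun x => complex.Im (f x)).

Lemma measurable_complexM d (X : measurableType d) (R : realType)
    (f g : X -> R[i]) :
  measurable_complex f -> measurable_complex g ->
  measurable_complex (fun x => f x * g x).
Proof.
move=> [f1 f2] [g1 g2]; split.
  rewrite (_ : (fun=> _) = fun x => complex.Re (f x) * complex.Re (g x) -
      complex.Im (f x) * complex.Im (g x)).
    by apply: measurable_funB; apply: measurable_funM.
  by apply/funext => x /=; case: (f x); case: (g x).
rewrite (_ : (fun=> _) = fun x => complex.Re (f x) * complex.Im (g x) +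
    complex.Im (f x) * complex.Re (g x)).
  by apply: measurable_funD; apply: measurable_funM.
by apply/funext => x /=; case: (f x); case: (g x).
Qed.

(** The real and imaginary parts are 1-Lipschitz, hence continuous. *)
Lemma measurable_torus_coord (R : realType) n (j : 'I_n) :
  measurable_complex (fun z : torus R n => val z 0 j).
Proof.
have lip_measurable (phi : R[i] -> R) :
    (forall x y, (`|phi x - phi y|%:C)%C <= `|x - y|) ->
    measurable_fun setT (fun z : torus R n => phi (val z 0 j)).
  move=> phi_lip; apply: (measurability _ (RGenOInfty.measurableE R)).
  move=> _ [_ [a ->] <-]; rewrite setTI; apply: sub_sigma_algebra => /=.
  exists [set z : 'rV[R[i]]_n | a < phi (z 0 j)]; last first.
    by apply/seteqP; split=> z /=; rewrite in_itv /= andbT.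
  rewrite openE => z /= az.
  apply/(@nbhs_ballP _ 'rV[R[i]^o]_n); exists ((phi (z 0 j) - a)%:C)%C => /=.
    by rewrite ltcR subr_gt0.
  move=> w [_ /(_ 0 j)]; rewrite -ball_normE /= => zw.
  have := le_lt_trans (phi_lip _ _) zw; rewrite ltcR => /ltr_normlW.
  by rewrite ltrD2l ltrN2.
split; apply: lip_measurable => x y.
  by rewrite -raddfB; exact: normc_ge_Re.
(* Up to sign, the imaginary part of [x - y] is the real part of its product
   by the imaginary unit. *)
rewrite -raddfB; have := normc_ge_Re ((x - y) * 'i%C).
rewrite ReiNIm normrN normrM; congr (_ <= _).
by rewrite [X in _ * X]normc_def /= expr0n add0r expr1n sqrtr1 mulr1.
Qed.

(** The modulus is at most the sum of the absolute values of the real and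
    imaginary parts, so half the radius of a ball in [V] will do. *)
Lemma torus_nbhs_box (R : realType) n (V : set 'rV[R[i]]_n) (z : 'rV[R[i]]_n) :
  @open 'rV[R[i]^o]_n V -> V z ->
  exists2 e : R, 0 < e & forall w : 'rV[R[i]]_n,
    (forall j, `|complex.Re (z 0 j) - complex.Re (w 0 j)| < e /\
               `|complex.Im (z 0 j) - complex.Im (w 0 j)| < e) -> V w.
Proof.
rewrite openE => /(_ z) /[apply] /(@nbhs_ballP _ 'rV[R[i]^o]_n)[e /= e0 zV].
have [re eE] : exists r : R, e = (r%:C)%C.
  by exists (complex.Re e); rewrite RRe_real // gtr0_real.
move: e0; rewrite eE ltcR => r0; exists (re / 2); first by rewrite divr_gt0.
move=> w zw; apply: zV; split; first by rewrite eE ltcR.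
move=> i j; rewrite ord1 -ball_normE /= eE.
have [zwR zwI] := zw j.
rewrite [X in `|X|]complexE (le_lt_trans (ler_normD _ _)) //.
rewrite normrM !raddfB /=.
have -> : `|'i%C : R[i]| = 1 by rewrite normc_def /= expr0n add0r expr1n sqrtr1.
rewrite mul1r !normc_def /= !subrr !expr0n !addr0 !sqrtr_sqr.
rewrite -rmorphD ltcR; lra.
Qed.

(** An open set is the union of the boxes with rational centre and rational
    size that it contains. There are countably many of them, and the preimage
    of a box is given by finitely many inequalities on the coordinates. *)
Lemma measurable_fun_torus d (X : measurableType d) (R : realType) n
    (f : X -> torus R n) :
  (forall j, measurable_complex (fun x => val (f x) 0 j)) ->
  measurable_fun setT f.
Proof.
move=> mf.
apply: (measurability _ (erefl : measurable = <<s @torus_open R n >>)).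
move=> _ [_ [V oV <-] <-].
rewrite setTI.
pose box (q : {ffun 'I_n -> rat * rat} * rat) (w : 'rV[R[i]]_n) := forall j,
  `|ratr (q.1 j).1 - complex.Re (w 0 j)| < ratr q.2 /\
  `|ratr (q.1 j).2 - complex.Im (w 0 j)| < ratr q.2 :> R.
have -> : f @^-1` (val @^-1` V) =
    \bigcup_(q in [set q | box q `<=` V]) [set x | box q (val (f x))].
  apply/seteqP; split=> [x /= Vfx|x [q qV] /qV //].
  have [e e0 eV] := torus_nbhs_box oV Vfx.
  (* The box is centred at a rational point [r]-close to [f x], and its points
     are [r]-close to the centre: they are [e]-close to [f x] as [2 r < e]. *)
  have [r /andP[]] : exists r : rat, 0 < (ratr r : R) < e / 2.
    have /rat_in_itvoo[r] : 0 < e / 2 by rewrite divr_gt0.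
    by rewrite in_itv /= => re; exists r.
  rewrite ltr0q => r0 re.
  have approx (a : R) : exists s : rat, `|ratr s - a| < ratr r.
    have /rat_in_itvoo[s] : a - ratr r < a + ratr r.
      by rewrite ltrD2l gtrN ?ltr0q.
    by rewrite in_itv /= => sa; exists s; rewrite ltr_distl.
  have [s sP] := choice (fun a => approx a).
  pose q := ([ffun j => (s (complex.Re (val (f x) 0 j)),
    s (complex.Im (val (f x) 0 j)))], r) : {ffun 'I_n -> rat * rat} * rat.
  exists q; last by move=> j; rewrite /= ffunE /=; split; exact: sP.
  move=> w qw; apply: eV => j; have := qw j; rewrite /= ffunE /= => -[wR wI].
  have := sP (complex.Re (val (f x) 0 j)).
  have := sP (complex.Im (val (f x) 0 j)).
  move: wR wI; rewrite !ltr_distl => /andP[? ?] /andP[? ?] /andP[? ?] /andP[? ?].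
  by split; apply/andP; split; lra.
rewrite bigcup_mkcond; apply: countable_bigcupT_measurable => // q.
case: ifPn => // _.
have -> : [set x | box q (val (f x))] = \bigcap_(j in [set: 'I_n])
    ([set x | `|ratr (q.1 j).1 - complex.Re (val (f x) 0 j)| < ratr q.2] `&`
     [set x | `|ratr (q.1 j).2 - complex.Im (val (f x) 0 j)| < ratr q.2]).
  by apply/seteqP; split=> x /= qx j; [move=> _|]; have := qx j; [|apply].
apply: fin_bigcap_measurable => // j _.
have mball (a e : R) (h : X -> R) : measurable_fun setT h ->
    measurable [set x | `|a - h x| < e].
  move=> mh; rewrite -[X in measurable X]setTI.
  have -> : [set x | `|a - h x| < e] = h @^-1` `]a - e, a + e[.
    by apply/seteqP; split=> x /=; rewrite in_itv /= distrC ltr_distl.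
  exact: mh.
by have [mRe mIm] := mf j; apply: measurableI; exact: mball.
Qed.

Lemma measurable_torus_mul (R : realType) n :
  measurable_fun setT (fun p : torus R n * torus R n => torus_mul p.1 p.2).
Proof.
apply: measurable_fun_torus => j.
under [X in measurable_complex X]eq_fun do rewrite /= mxE.
have [mRe mIm] := measurable_torus_coord R j.
apply: measurable_complexM; split.
- exact: (measurableT_comp mRe measurable_fst).
- exact: (measurableT_comp mIm measurable_fst).
- exact: (measurableT_comp mRe measurable_snd).
- exact: (measurableT_comp mIm measurable_snd).
Qed.

Lemma measurable_torus_hom (R : realType) n m (A : 'M[int]_(n, m)) :
  measurable_fun setT (@torus_hom R n m A).
Proof.
pose meas (f : torus R m -> R[i]) := measurable_complex f.
have meas1 : meas (fun=> 1) by split; exact: measurable_cst.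
have measX f k : meas f -> meas (fun z => f z ^+ k).
  move=> mf; elim: k => [|k IH]; first exact: meas1.
  by under [X in meas X]eq_fun do rewrite exprS; exact: measurable_complexM.
have meas_coord j : meas (fun z => val z 0 j) := measurable_torus_coord R j.
(* On the unit circle the inverse is the conjugate. *)
have measV j : meas (fun z => (val z 0 j)^-1).
  have [mRe mIm] := meas_coord j.
  under [X in meas X]eq_fun => z.
    rewrite invc_norm (eqP (forallP (valP z) j)) expr1n invr1 mul1r.
    over.
  split.
    rewrite (_ : (fun=> _) = fun z : torus R m => complex.Re (val z 0 j)) //.
    by apply/funext => z /=; case: (sval z 0 j).
  rewrite (_ : (fun=> _) = fun z : torus R m => - complex.Im (val z 0 j)).
    exact: measurable_funN.
  by apply/funext => z /=; case: (sval z 0 j).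
have meas_exprz j (e : int) : meas (fun z => val z 0 j ^ e).
  case: e => k; first exact: measX.
  rewrite (_ : (fun=> _) = fun z : torus R m => ((val z 0 j)^-1) ^+ k.+1).
    exact: measX.
  by apply/funext => z; rewrite exprVn.
have meas_prod i : meas (fun z => \prod_j val z 0 j ^ A i j).
  elim: (index_enum _) => [|j s IH].
    by under [X in meas X]eq_fun do rewrite big_nil; exact: meas1.
  under [X in meas X]eq_fun do rewrite big_cons.
  exact: (measurable_complexM (meas_exprz j (A i j)) IH).
apply: measurable_fun_torus => i.
by under [X in measurable_complex X]eq_fun do rewrite /= mxE; exact: meas_prod.
Qed.

(** * Haar measure *)

Lemma torus_inv_subproof (R : realType) n (z : torus R n) :
  torus_pred (\row_j (val z 0 j)^-1).
Proof.
by apply/forallP => j; rewrite mxE normfV (eqP (forallP (valP z) j)) invr1.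
Qed.

Definition torus_inv (R : realType) n (z : torus R n) : torus R n :=
  Sub (\row_j (val z 0 j)^-1) (torus_inv_subproof z).

Lemma torus_mulK (R : realType) n (z : torus R n) :
  cancel (torus_mul z) (torus_mul (torus_inv z)).
Proof.
move=> w; apply: val_inj; apply/rowP => j.
by rewrite /= !mxE mulKf ?torus_coord_neq0.
Qed.

Lemma torus_mulVK (R : realType) n (z : torus R n) :
  cancel (torus_mul (torus_inv z)) (torus_mul z).
Proof.
move=> w; apply: val_inj; apply/rowP => j.
by rewrite /= !mxE mulVKf ?torus_coord_neq0.
Qed.

Lemma torus_invK (R : realType) n : involutive (@torus_inv R n).
Proof. by move=> z; apply: val_inj; apply/rowP => j; rewrite /= !mxE invrK. Qed.

Lemma torus_mulC (R : realType) n : commutative (@torus_mul R n).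
Proof. by move=> z w; apply: val_inj; apply/rowP => j; rewrite /= !mxE mulrC. Qed.

Lemma image_torus_mul (R : realType) n (z : torus R n) (A : set (torus R n)) :
  torus_mul z @` A = torus_mul (torus_inv z) @^-1` A.
Proof.
apply/seteqP; split=> [_ [w Aw <-]|w Aw] /=; first by rewrite torus_mulK.
by exists (torus_mul (torus_inv z) w) => //; rewrite torus_mulVK.
Qed.

Lemma haar_preimage (R : realType) n (tau : probability (torus R n) R) z A :
  normalized_haar tau -> measurable A -> tau (torus_mul z @^-1` A) = tau A.
Proof.
move=> htau mA; rewrite -(htau (torus_inv z) _ mA); congr (tau _).
by rewrite image_torus_mul torus_invK.
Qed.

(** For both invariant probabilities, all sections of the set of pairs whose
    product lies in [A] have the measure of [A]; integrating the sections in the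
    two possible orders gives [mu A] and [nu A]. *)
Lemma haar_unique (R : realType) n (mu nu : probability (torus R n) R) A :
  normalized_haar mu -> normalized_haar nu -> measurable A -> mu A = nu A.
Proof.
move=> hmu hnu mA.
pose S : set (torus R n * torus R n) := (fun p => torus_mul p.1 p.2) @^-1` A.
have mS : measurable S.
  by rewrite -[S]setTI; apply: measurable_torus_mul.
transitivity ((mu \x^ nu)%E S).
  rewrite /product_measure2 -[LHS]mule1 -(@probability_setT _ _ _ nu).
  rewrite -integral_cst //; apply: eq_integral => y _ /=.
  rewrite -[LHS](haar_preimage y hmu mA); congr (mu _).
  by apply/seteqP; split=> x; rewrite ysectionE /S /= torus_mulC.
rewrite -(@product_measure_unique _ _ _ _ _ mu nu (mu \x^ nu)%E) //; last first.
  by move=> B D mB mD; exact: product_measure2E.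
rewrite /product_measure1 -[RHS]mule1 -(@probability_setT _ _ _ mu).
rewrite -integral_cst //; apply: eq_integral => x _ /=.
rewrite -[RHS](haar_preimage x hnu mA); congr (nu _).
by apply/seteqP; split=> y; rewrite xsectionE.
Qed.

(** The image measure is invariant under the translations by the elements
    [torus_hom A w]; by surjectivity these are all translations. *)
Lemma haar_torus_hom (R : realType) n m (tau_m : probability (torus R m) R)
    (tau_n : probability (torus R n) R) (A : 'M[int]_(n, m)) :
  normalized_haar tau_m -> normalized_haar tau_n ->
  (forall z, exists w, torus_hom A w = z :> torus R n) ->
  forall E, measurable E -> tau_m (torus_hom A @^-1` E) = tau_n E.
Proof.
move=> hm hn surjA E mE.
pose q : {mfun torus R m >-> torus R n} := HB.pack (@torus_hom R n m A)
  (isMeasurableFun.Build _ _ _ _ _ (@measurable_torus_hom R n m A)).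
apply: (@haar_unique R n (distribution tau_m q) tau_n) => // z F mF.
have [w wz] := surjA z.
have mqF : measurable (torus_hom A @^-1` F).
  by rewrite -[X in measurable X]setTI; exact: measurable_torus_hom.
apply: etrans (hm w _ mqF).
change (tau_m (torus_hom A @^-1` (torus_mul z @` F)) =
  tau_m (torus_mul w @` (torus_hom A @^-1` F))); congr (tau_m _).
apply/seteqP; split=> [x [y Fy zy]|_ [x Fx <-]] /=; last first.
  by exists (torus_hom A x) => //; rewrite torus_hom_mul wz.
exists (torus_mul (torus_inv w) x); last by rewrite torus_mulVK.
rewrite /preimage /=; suff -> : torus_hom A (torus_mul (torus_inv w) x) = y by [].
apply: (can_inj (torus_mulK z)).
by rewrite zy -[in LHS]wz -torus_hom_mul torus_mulVK.
Qed.

(** One nonzero entry [A 0 k] is enough: a root [x] of [x ^ A 0 k = z] in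
    coordinate [k], and 1 in the other coordinates. *)
Lemma torus_hom_surjective (R : realType) m (A : 'M[int]_(1, m)) :
  A != 0 -> forall z : torus R 1, exists w, torus_hom A w = z.
Proof.
move=> A0 z.
have [k k0] : exists k, A 0 k != 0.
  apply/existsP; apply: contraNT A0; rewrite negb_exists => /forallP A0.
  by apply/eqP/rowP => k; rewrite mxE; apply/eqP; rewrite -[_ == _]negbK A0.
have [x x1 xk] : exists2 x : R[i], `|x| = 1 & x ^ A 0 k = val z 0 0.
  have root_z (d : nat) (c : R[i]) : (0 < d)%N -> `|c| = 1 ->
      exists2 x : R[i], `|x| = 1 & x ^+ d = c.
    move=> d0 c1; exists (d.-root c)%R; last exact: rootCK.
    by apply: (pexpIrn d0); rewrite ?nnegrE // -normrX rootCK // expr1n.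
  have z1 := eqP (forallP (valP z) 0).
  case: (A 0 k) k0 => d d0.
    by have [|x x1 xd] := root_z d _ _ z1; [rewrite lt0n | exists x].
  have [//||x x1 xd] := root_z d.+1 (val z 0 0)^-1; first by rewrite normfV z1 invr1.
  by exists x => //; rewrite -[LHS]/((x ^+ d.+1)^-1) xd invrK.
have wP : torus_pred (\row_j if j == k then x else 1).
  by apply/forallP => j; rewrite mxE; case: ifP; rewrite ?x1 ?normr1.
exists (Sub _ wP); apply: val_inj; apply/rowP => i; rewrite ord1 /= mxE.
rewrite (bigD1 k) //= mxE eqxx xk big1 ?mulr1 // => j /negbTE jk.
by rewrite mxE jk exp1rz.
Qed.

(** * Integrals of partially defined functions *)

(** Two representatives of [g] both agree with [g], hence with each other, almost
    everywhere. *)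
Lemma pintegral_rep (R : realType) n (mu : probability (torus R n) R)
    (g : partial_fun R n) (h : torus R n -> R[i]) :
  L1_rep mu g h ->
  pintegral mu g =
    ((\int[mu]_x complex.Re (h x)) +i* (\int[mu]_x complex.Im (h x)))%C.
Proof.
move=> gh; rewrite /pintegral; set h' := xget _ _.
have gh' : L1_rep mu g h' by exact: (xgetPex (fun=> 0) (ex_intro _ _ gh)).
case: gh gh' => iRe iIm gh [iRe' iIm' gh'].
have hh' : {ae mu, forall x, h' x = h x}.
  by apply: filterS2 gh gh' => x -> [].
congr (Complex _ _); congr fine; apply: ae_eq_integral => //;
  try by [apply: measurable_int iRe' | apply: measurable_int iRe
         |apply: measurable_int iIm' | apply: measurable_int iIm];
  by apply: filterS hh' => x -> _.
Qed.

Section measure_preserving.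
Context (R : realType) (n m : nat).
Context (mu : probability (torus R m) R) (nu : probability (torus R n) R).
Context (q : torus R m -> torus R n) (mq : measurable_fun setT q).
Context (q_mu : forall E, measurable E -> mu (q @^-1` E) = nu E).

Let integrable_comp (f : torus R n -> \bar R) :
  nu.-integrable setT f -> mu.-integrable setT (f \o q).
Proof.
move=> /integrableP[mf foo]; apply/integrableP; split.
  exact: measurableT_comp.
apply: le_lt_trans foo.
rewrite -(ge0_integral_pushforward mq mu (D := setT) (f := fun x => `|f x|%E)) //.
  rewrite le_eqVlt; apply/orP; left; apply/eqP.
  by apply: eq_measure_integral => E mE _; exact: q_mu.
exact: measurableT_comp.
Qed.

Let integral_comp (f : torus R n -> \bar R) : nu.-integrable setT f ->
  (\int[mu]_x f (q x) = \int[nu]_y f y)%E.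
Proof.
move=> fi; have [mf _] := integrableP _ _ _ fi.
rewrite -(integral_pushforward mq mf (mu := mu) (D := setT)) //.
  by apply: eq_measure_integral => E mE _; exact: q_mu.
exact: integrable_comp.
Qed.

Lemma L1_rep_comp (g : partial_fun R n) (h : torus R n -> R[i]) :
  L1_rep nu g h -> L1_rep mu (g \o q) (h \o q).
Proof.
move=> [iRe iIm [N [mN N0 Ngh]]]; split.
- exact: integrable_comp iRe.
- exact: integrable_comp iIm.
exists (q @^-1` N); split; first by rewrite -[X in measurable X]setTI; exact: mq.
  by rewrite q_mu.
by move=> x; exact: Ngh.
Qed.

Lemma pintegral_comp (g : partial_fun R n) :
  inL1 nu g -> pintegral mu (g \o q) = pintegral nu g.
Proof.
move=> [h gh]; rewrite (pintegral_rep gh) (pintegral_rep (L1_rep_comp gh)).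
case: gh => iRe iIm _.
by congr (Complex _ _); congr fine; rewrite -integral_comp.
Qed.
End measure_preserving.

(** * The case of dimension one, and conclusion *)

Lemma integral_is_limit_dim1 (R : realType)
    (tau : forall n, probability (torus R n) R)
    (htau : forall n, normalized_haar (tau n))
    (g : partial_fun R 1) (m : nat) :
  inL1 (tau 1) g -> integral_is_limit tau m g.
Proof.
move=> gL1.
have A_neq0 (A : 'M[int]_(1, m)) : (2%:E <= boyd_height R A)%E -> A != 0.
  move=> /le_boyd_heightP hA; apply/eqP => A0.
  (* The zero matrix has height 1, as the vector (1) kills it. *)
  have := hA 1%:M; rewrite A0 mulmx0 oner_eq0 => /(_ isT erefl).
  by rewrite /supnorm big_ord1 mxE ler_nat.
have pres (A : 'M[int]_(1, m)) : (2%:E <= boyd_height R A)%E ->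
    forall E, measurable E -> tau m (torus_hom A @^-1` E) = tau 1 E.
  by move=> /A_neq0 A0; apply: haar_torus_hom => //; exact: torus_hom_surjective.
split.
  exists 2 => A hA; have [h gh] := gL1.
  by exists (h \o torus_hom A); apply: L1_rep_comp gh => //;
    [exact: measurable_torus_hom | exact: pres].
move=> eps eps0; exists 2 => A hA.
rewrite (pintegral_comp (@measurable_torus_hom R 1 m A) (pres A hA) gL1).
by rewrite subrr normr0 ltcR.
Qed.

Theorem corollary1p3 (R : realType)
  (tau : forall n : nat, probability (torus R n) R)
  (htau : forall n : nat, normalized_haar (tau n))
  (C : forall n : nat, set (partial_fun R n)) (hC : boyd_lawton tau C)
  (n : nat) (hn : (1 <= n)%N) (g : partial_fun R n) (hg : C n g)
  (m : nat) (hm : (0 < m)%N) :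
  integral_is_limit tau m g.
Proof.
have [n1|n2] := leqP n 1; last exact (integral_is_limit_dim_ge2 hC n2 hg hm).
have {}n1 : n = 1%N by apply/eqP; rewrite eqn_leq n1.
subst n; apply: integral_is_limit_dim1 => //; exact: (bl_integrable hC hn hg).
Qed.
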